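(* Let $g\in\mathscr{L}$, let $\mathbb{A}=(A_1,\ldots,A_n)$ be an $n$-tuple of positive definite matrices in $\mathcal{M}_k$ with $mI\le A_i\le MI$ $(i=1,\ldots,n)$ for some scalars $0<m<M$, and let $w=(w_1,\ldots,w_n)$ be a weight vector. Put $h=\frac{M}{m}$ and $\mathbb{A}^p=(A_1^p,\ldots,A_n^p)$. Then for all $p\ge 1$ and every unitarily invariant norm $|||\cdot|||$ on $\mathcal{M}_k$, $$|||\sigma_g(w;\mathbb{A}^p)|||\le K(m,M,p)\,K(h,2)^p\,|||\sigma_g(w;\mathbb{A})^p|||,$$ where $$K(m,M,p)=\frac{mM^p-Mm^p}{(p-1)(M-m)}\left(\frac{p-1}{p}\,\frac{M^p-m^p}{mM^p-Mm^p}\right)^p$$ for $p>1$, and $K(m,M,1)=1$. In particular, if $\sigma_g(w;\mathbb{A})\le I$, then $$\sigma_g(w;\mathbb{A}^p)\le K(m,M,p)\,K(h,2)^p\,I.$$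
   Context: $\mathcal{M}_k$ is the algebra of complex $k\times k$ matrices, $I$ the identity matrix, and $A\le B$ for Hermitian matrices means $B-A$ is positive semidefinite. A weight vector is $w=(w_1,\ldots,w_n)$ with all $w_i>0$ and $\sum_{i=1}^n w_i=1$. $\mathscr{L}$ is the set of all operator monotone functions $g$ on $(0,\infty)$ (real-valued functions, applied to positive definite matrices by functional calculus, with $A\le B\Rightarrow g(A)\le g(B)$ for positive definite matrices of every size) satisfying $g(1)=0$ and $g'(1)=1$. For $g\in\mathscr{L}$, a weight vector $w$ and positive definite $\mathbb{A}=(A_1,\ldots,A_n)$, $\sigma_g(w;\mathbb{A})$ denotes the (unique) positive definite solution $X$ of the generalized Karcher equation $\sum_{i=1}^{n}w_i\,g\left(X^{-1/2}A_iX^{-1/2}\right)=0$. The Kantorovich constant is $K(h,2)=\frac{(h+1)^2}{4h}$. A norm $|||\cdot|||$ on $\mathcal{M}_k$ is unitarily invariant if $|||UXV|||=|||X|||$ for all $X\in\mathcal{M}_k$ and all unitary $U,V\in\mathcal{M}_k$. *)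

(* Defs.v *)
From HB Require Import structures.
From mathcomp Require Import all_boot all_order all_algebra.
From mathcomp Require Import complex.
From mathcomp Require Import all_classical all_reals all_analysis.
Set Implicit Arguments.
Unset Strict Implicit.
Unset Printing Implicit Defensive.
Import Order.TTheory GRing.Theory Num.Theory.
Import numFieldNormedType.Exports.
Local Open Scope ring_scope.
Local Open Scope sesquilinear_scope.

Definition psdmx (R : realType) (k : nat) (A : 'M[R[i]]_k) : Prop :=
  A \is hermsymmx /\ forall x : 'cV[R[i]]_k, 0 <= (x ^t* *m A *m x) 0 0.

Definition pdmx (R : realType) (k : nat) (A : 'M[R[i]]_k) : Prop :=
  A \is hermsymmx /\
  forall x : 'cV[R[i]]_k, x != 0 -> 0 < (x ^t* *m A *m x) 0 0.

Definition loewner_le (R : realType) (k : nat) (A B : 'M[R[i]]_k) : Prop :=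
  psdmx (B - A).

Definition rscalar_mx (R : realType) (k : nat) (c : R) : 'M[R[i]]_k :=
  (c%:C%C)%:M.

(* Functional calculus f(A) for Hermitian A, for which
   A = invmx U *m diag_mx d *m U with U := spectralmx A unitary and
   d := spectral_diag A real. Not meaningful when A is not Hermitian. *)
Definition funmx (R : realType) (k : nat) (f : R -> R) (A : 'M[R[i]]_k) :
    'M[R[i]]_k :=
  invmx (spectralmx A)
  *m diag_mx (map_mx (fun z : R[i] => (f (complex.Re z))%:C%C)
                     (spectral_diag A))
  *m spectralmx A.

Definition powmx (R : realType) (k : nat) (A : 'M[R[i]]_k) (p : R) :
    'M[R[i]]_k :=
  funmx (fun x => x `^ p) A.

(* Only the values of g on positive reals are used. *)
Definition operator_monotone (R : realType) (g : R -> R) : Prop :=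
  forall (k : nat) (A B : 'M[R[i]]_k),
    pdmx A -> pdmx B -> loewner_le A B -> loewner_le (funmx g A) (funmx g B).

Definition scrL (R : realType) (g : R -> R) : Prop :=
  [/\ operator_monotone g, g 1 = 0 & is_derive (1 : R) 1 g 1].

Definition weight_vector (R : realType) (n : nat) (w : 'I_n -> R) : Prop :=
  (forall i, 0 < w i) /\ \sum_(i < n) w i = 1.

(* X = sigma_g(w; A). This equation is known to have exactly one positive
   definite solution for g in scrL, w a weight vector and A_i positive
   definite, so this relation is the graph of sigma_g(w; _). *)
Definition is_sigma (R : realType) (n k : nat) (g : R -> R) (w : 'I_n -> R)
    (A : 'I_n -> 'M[R[i]]_k) (X : 'M[R[i]]_k) : Prop :=
  pdmx X /\
  \sum_(i < n) (w i)%:C%C *: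
      funmx g (powmx X (- 2^-1) *m A i *m powmx X (- 2^-1)) = 0.

Definition matrix_norm (R : realType) (k : nat) (N : 'M[R[i]]_k -> R) : Prop :=
  [/\ forall X Y, N (X + Y) <= N X + N Y,
      forall (c : R[i]) X, N (c *: X) = ComplexField.Normc.normc c * N X
    & forall X, N X = 0 -> X = 0].

Definition unitarily_invariant_norm (R : realType) (k : nat)
    (N : 'M[R[i]]_k -> R) : Prop :=
  matrix_norm N /\
  forall U X V : 'M[R[i]]_k,
    U \is unitarymx -> V \is unitarymx -> N (U *m X *m V) = N X.

Definition kantorovich (R : realType) (h : R) : R := (h + 1) ^+ 2 / (4 * h).

Definition gen_kantorovich (R : realType) (m M p : R) : R :=
  if p == 1 then 1
  else (m * M `^ p - M * m `^ p) / ((p - 1) * (M - m))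
       * ((p - 1) / p
          * ((M `^ p - m `^ p) / (m * M `^ p - M * m `^ p))) `^ p.

(* Main.v *)
(* Let [B = sum_i w_i A_i]. Operator monotonicity and the normalization of [g]
   give [1 - 1/x <= g x <= x - 1], so the Karcher equation yields
   [Sp <= sum_i w_i A_i^p] and [S^-1 <= sum_i w_i A_i^-1]. The chord of [x^p] on
   [[m, M]] bounds the first sum by an affine function of [B]. From the second,
   [A_i^-1 <= (m + M - A_i) / (m M)] and [S + c^2 S^-1 >= 2 c] with
   [c = 2 m M / (m + M)] give [B <= K(h,2) S]. As the affine function of [s] so
   obtained lies below [K(m,M,p) (K(h,2) s)^p] for every [s > 0], functional
   calculus of the single matrix [S] gives the operator inequality
   [Sp <= K(m,M,p) K(h,2)^p S^p], and unitarily invariant norms are monotone on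
   positive definite matrices. *)

Require Import Defs.
From HB Require Import structures.
From mathcomp Require Import all_boot all_order all_algebra.
From mathcomp Require Import complex.
From mathcomp Require Import all_classical all_reals all_analysis.
From mathcomp Require Import ring lra.
Import Order.TTheory GRing.Theory Num.Theory.
Import numFieldNormedType.Exports.
Set Implicit Arguments.
Unset Strict Implicit.
Unset Printing Implicit Defensive.
Local Open Scope ring_scope.
Local Open Scope sesquilinear_scope.

(** * Loewner order and unitary diagonalization *)

Section Adjoint.
Variable C : numClosedFieldType.

Lemma mxadjM m n p (A : 'M[C]_(m, n)) (B : 'M[C]_(n, p)) :
  (A *m B)^t* = B^t* *m A^t*.
Proof. by rewrite trmx_mul map_mxM. Qed.

Lemma mxadjD m n (A B : 'M[C]_(m, n)) : (A + B)^t* = A^t* + B^t*.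
Proof. by rewrite linearD /= map_mxD. Qed.

Lemma mxadjN m n (A : 'M[C]_(m, n)) : (- A)^t* = - A^t*.
Proof. by rewrite linearN /= map_mxN. Qed.

Lemma mxadjZ m n (a : C) (A : 'M[C]_(m, n)) : (a *: A)^t* = a^* *: A^t*.
Proof. by rewrite linearZ /= map_mxZ. Qed.

Lemma hermsymP n (A : 'M[C]_n) : A \is hermsymmx <-> A^t* = A.
Proof.
split=> [/is_hermitianmxP|h]; first by rewrite expr0 scale1r => <-.
by apply/is_hermitianmxP; rewrite expr0 scale1r h.
Qed.

Lemma hermsymB n (A B : 'M[C]_n) :
  A \is hermsymmx -> B \is hermsymmx -> A - B \is hermsymmx.
Proof. by move=> /hermsymP hA /hermsymP hB; apply/hermsymP; rewrite mxadjD mxadjN hA hB. Qed.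

Lemma unitarymx_adjl n (U : 'M[C]_n) : U \is unitarymx -> U^t* *m U = 1%:M.
Proof. by move/unitarymxP/mulmx1C. Qed.

End Adjoint.

Section Loewner.
Variables (R : realType).
Local Notation C := R[i].
Local Notation "x %:RC" := (x%:C%C : C) (at level 2, format "x %:RC").

Lemma conj_RC (x : R) : (x%:RC)^* = x%:RC.
Proof. by apply/CrealP; rewrite complex_real. Qed.

Lemma psdmx_gram n k (Y : 'M[C]_(n, k)) : psdmx (Y^t* *m Y).
Proof.
split; first by apply/hermsymP; rewrite mxadjM trmxCK.
move=> x; rewrite mulmxA -mulmxA -mxadjM mxE; apply: sumr_ge0 => j _.
by rewrite !mxE mulrC mul_conjC_ge0.
Qed.

Lemma psdmx_congr n k (A : 'M[C]_n) (Y : 'M[C]_(n, k)) :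
  psdmx A -> psdmx (Y^t* *m A *m Y).
Proof.
case=> /hermsymP hA pA; split; first by apply/hermsymP; rewrite !mxadjM trmxCK hA mulmxA.
by move=> x; have := pA (Y *m x); rewrite mxadjM !mulmxA.
Qed.

Lemma psdmx_congrH k (A Y : 'M[C]_k) :
  Y \is hermsymmx -> psdmx A -> psdmx (Y *m A *m Y).
Proof. by move=> /hermsymP hY /(psdmx_congr Y); rewrite hY. Qed.

Lemma pdmx_congr k (A Y : 'M[C]_k) :
  Y \in unitmx -> pdmx A -> pdmx (Y^t* *m A *m Y).
Proof.
move=> uY [/hermsymP hA pA]; split; first by apply/hermsymP; rewrite !mxadjM trmxCK hA mulmxA.
move=> x x0; have := pA (Y *m x); rewrite mxadjM !mulmxA; apply.
by apply: contra x0 => /eqP h; rewrite -(mulKmx uY x) h mulmx0.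
Qed.

Lemma psdmxD k (A B : 'M[C]_k) : psdmx A -> psdmx B -> psdmx (A + B).
Proof.
move=> [/hermsymP hA pA] [/hermsymP hB pB]; split.
  by apply/hermsymP; rewrite mxadjD hA hB.
by move=> x; rewrite mulmxDr mulmxDl mxE addr_ge0.
Qed.

Lemma psdmxZ k (c : R) (A : 'M[C]_k) : 0 <= c -> psdmx A -> psdmx (c%:RC *: A).
Proof.
move=> c0 [/hermsymP hA pA]; split.
  by apply/hermsymP; rewrite mxadjZ hA conj_RC.
by move=> x; rewrite -scalemxAr -scalemxAl mxE mulr_ge0 ?ler0c.
Qed.

Lemma psdmx0 k : psdmx (0 : 'M[C]_k).
Proof. by have := @psdmx_gram 0 k 0; rewrite mulmx0. Qed.

Lemma psdmx_sum n k (F : 'I_n -> 'M[C]_k) :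
  (forall i, psdmx (F i)) -> psdmx (\sum_i F i).
Proof. elim: n F => [|n IH] F h; first by rewrite big_ord0; apply: psdmx0.
by rewrite big_ord_recl; apply: psdmxD; [exact: h | exact: IH]. Qed.

Lemma psdmx_diag_ge0 k (A : 'M[C]_k) i : psdmx A -> 0 <= A i i.
Proof.
case=> _ /(_ (delta_mx i 0)); rewrite trmx_delta map_delta_mx.
by rewrite -rowE -colE !mxE.
Qed.

Lemma loewner_trans k (A B D : 'M[C]_k) :
  loewner_le A B -> loewner_le B D -> loewner_le A D.
Proof.
by rewrite /loewner_le => h1 h2; have := psdmxD h1 h2; rewrite addrC addrA subrK.
Qed.

Lemma pdmx_psd k (A : 'M[C]_k) : pdmx A -> psdmx A.
Proof.
case=> hA pA; split=> // x; have [->|x0] := eqVneq x 0.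
  by rewrite mulmx0 mxE.
exact/ltW/pA.
Qed.

Lemma pdmxZ k (c : R) (A : 'M[C]_k) : 0 < c -> pdmx A -> pdmx (c%:RC *: A).
Proof.
move=> c0 [/hermsymP hA pA]; split.
  by apply/hermsymP; rewrite mxadjZ hA conj_RC.
by move=> x x0; rewrite -scalemxAr -scalemxAl mxE mulr_gt0 ?ltr0c ?pA ?ltcR.
Qed.

(** Taking the entries in [R] builds the reality of the eigenvalues into the type and keeps all
    spectral inequalities in the real field. *)
Definition rdiag k (d : 'rV[R]_k) : 'M[C]_k := diag_mx (map_mx (fun x => x%:RC) d).

Lemma rdiag_adj k (d : 'rV[R]_k) : (rdiag d)^t* = rdiag d.
Proof.
rewrite /rdiag tr_diag_mx map_diag_mx.
suff -> : (map_mx (fun x => x%:RC) d)^Num.Def.conjC = map_mx (fun x => x%:RC) d by [].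
by apply/rowP => j; rewrite !mxE; exact: conj_RC.
Qed.

Lemma rdiagM k (d e : 'rV[R]_k) : rdiag d *m rdiag e = rdiag (\row_j (d 0 j * e 0 j)).
Proof.
rewrite /rdiag mulmx_diag; congr diag_mx.
by apply/rowP => j; rewrite !mxE rmorphM.
Qed.

Lemma rdiagD k (d e : 'rV[R]_k) : rdiag d + rdiag e = rdiag (d + e).
Proof.
rewrite /rdiag -linearD /=; congr diag_mx.
by apply/rowP => j; rewrite !mxE rmorphD.
Qed.

Lemma rdiagZ k (c : R) (d : 'rV[R]_k) : c%:RC *: rdiag d = rdiag (c *: d).
Proof.
rewrite /rdiag -linearZ /=; congr diag_mx.
by apply/rowP => j; rewrite !mxE rmorphM.
Qed.

(** [U] ranges over all unitary matrices, whereas [funmx] is tied to the particular choice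
    [spectralmx A]; this freedom lets diagonalizations be picked by hand. *)
Definition spec k (U : 'M[C]_k) (d : 'rV[R]_k) : 'M[C]_k := U^t* *m rdiag d *m U.

Lemma spec_exists k (A : 'M[C]_k) : A \is hermsymmx ->
  exists U d, U \is unitarymx /\ A = spec U d.
Proof.
move=> hA; exists (spectralmx A), (map_mx (@complex.Re R) (spectral_diag A)).
split; first exact: spectral_unitarymx.
have hd : map_mx (fun x => x%:RC) (map_mx (@complex.Re R) (spectral_diag A))
          = spectral_diag A.
  apply/rowP => j; rewrite !mxE RRe_real //.
  by have /mxOverP := hermitian_spectral_diag_real hA; apply.
rewrite /spec /rdiag hd -invmx_unitary ?spectral_unitarymx //.
exact/orthomx_spectralP/hermitian_normalmx.
Qed.

Lemma spec_herm k U (d : 'rV[R]_k) : spec U d \is hermsymmx.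
Proof.
by apply/hermsymP; rewrite /spec !mxadjM trmxCK mulmxA rdiag_adj.
Qed.

(* With [W := V U^*], [e W = W d] forces [W i j = 0] unless [e i = d j];
   hence [f e W = W f d]. *)
Lemma diag_calculus k (f : R -> R) (U V : 'M[C]_k) (d : 'rV[R]_k) (e : 'rV[C]_k) :
  U \is unitarymx -> V \is unitarymx -> V^t* *m diag_mx e *m V = spec U d ->
  V^t* *m diag_mx (map_mx (fun z => (f (complex.Re z))%:RC) e) *m V
  = spec U (map_mx f d).
Proof.
move=> hU hV hVU; set fe := map_mx _ e.
have hW : diag_mx e *m (V *m U^t*)
          = V *m U^t* *m rdiag d.
  have : V *m (V^t* *m diag_mx e *m V) *m U^t* = V *m spec U d *m U^t* by rewrite hVU.
  rewrite /spec !mulmxA (unitarymxP hV) mul1mx => ->.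
  by rewrite -[LHS]mulmxA (unitarymxP hU) mulmx1.
have hfW : diag_mx fe *m (V *m U^t*)
           = V *m U^t* *m rdiag (map_mx f d).
  move: (V *m U^t*) hW => W hW; apply/matrixP => i j; have /matrixP/(_ i j) := hW.
  rewrite !mul_diag_mx !mul_mx_diag !mxE ![W i j * _]mulrC.
  have [->|W0] := eqVneq (W i j) 0; first by rewrite !mulr0.
  by move/(mulIf W0) => ->.
have -> : V^t* *m diag_mx fe *m V = V^t* *m (diag_mx fe *m (V *m U^t*)) *m U.
  by rewrite !mulmxA -[RHS]mulmxA (unitarymx_adjl hU) mulmx1.
by rewrite hfW /spec !mulmxA (unitarymx_adjl hV) mul1mx.
Qed.

(** Independence of the functional calculus from the diagonalization: an arbitrary one and the
    spectral one represent the same matrix, so [diag_calculus] applies. From here on, identities for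
    functions of a single matrix are checked eigenvalue by eigenvalue. *)
Lemma funmx_spec k (f : R -> R) U (d : 'rV[R]_k) : U \is unitarymx ->
  funmx f (spec U d) = spec U (map_mx f d).
Proof.
move=> hU; have hV := spectral_unitarymx (spec U d).
rewrite /funmx (invmx_unitary hV); apply: (diag_calculus _ hU hV).
rewrite -(invmx_unitary hV); apply/esym/orthomx_spectralP.
exact/hermitian_normalmx/spec_herm.
Qed.

Lemma specM k U (d e : 'rV[R]_k) : U \is unitarymx ->
  spec U d *m spec U e = spec U (\row_j (d 0 j * e 0 j)).
Proof.
move=> hU; rewrite /spec -rdiagM !mulmxA -(mulmxA _ U) (unitarymxP hU) mulmx1.
by rewrite -(mulmxA _ (rdiag d)).
Qed.

Lemma specD k U (d e : 'rV[R]_k) : spec U d + spec U e = spec U (d + e).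
Proof. by rewrite /spec -mulmxDl -mulmxDr rdiagD. Qed.

Lemma specZ k U (c : R) (d : 'rV[R]_k) : c%:RC *: spec U d = spec U (c *: d).
Proof. by rewrite /spec scalemxAl scalemxAr rdiagZ. Qed.

Lemma spec_const k U (c : R) : U \is unitarymx ->
  spec U (const_mx c) = rscalar_mx k c.
Proof.
move=> hU; rewrite /spec /rdiag /rscalar_mx map_const_mx diag_const_mx mul_mx_scalar -scalemxAl.
by rewrite (unitarymx_adjl hU) scalemx1.
Qed.

Lemma spec_quad k U (d : 'rV[R]_k) (x : 'cV[C]_k) :
  (x^t* *m spec U d *m x) 0 0 = \sum_j (d 0 j)%:RC * `|(U *m x) j 0| ^+ 2.
Proof.
have -> : x^t* *m spec U d *m x = (U *m x)^t* *m rdiag d *m (U *m x).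
  by rewrite /spec mxadjM !mulmxA.
move: (U *m x) => y; rewrite mul_mx_diag mxE; apply: eq_bigr => j _.
by rewrite !mxE normCK; ring.
Qed.

Lemma spec_eigen k U (d : 'rV[R]_k) j : U \is unitarymx ->
  let x : 'cV[C]_k := U^t* *m delta_mx j 0 in
  (x^t* *m spec U d *m x) 0 0 = (d 0 j)%:RC.
Proof.
move=> hU /=; rewrite spec_quad mulmxA (unitarymxP hU) mul1mx (bigD1 j) //=.
rewrite !mxE !eqxx normr1 expr1n mulr1 big1 ?addr0 // => l lj.
by rewrite !mxE (negbTE lj) normr0 expr0n mulr0.
Qed.

Lemma psdmx_spec k U (d : 'rV[R]_k) : U \is unitarymx ->
  psdmx (spec U d) <-> forall j, 0 <= d 0 j.
Proof.
move=> hU; split=> [[_ h] j|h].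
  by have := h (U^t* *m delta_mx j 0); rewrite spec_eigen // ler0c.
split; first exact: spec_herm.
by move=> x; rewrite spec_quad sumr_ge0 // => j _; rewrite mulr_ge0 ?ler0c ?exprn_ge0.
Qed.

Lemma pdmx_spec k U (d : 'rV[R]_k) : U \is unitarymx ->
  pdmx (spec U d) <-> forall j, 0 < d 0 j.
Proof.
move=> hU; split=> [[_ h] j|h].
  have := h (U^t* *m delta_mx j 0); rewrite spec_eigen // ltcR; apply.
  apply/eqP => /(congr1 (mulmx U)); rewrite mulmxA (unitarymxP hU) mul1mx mulmx0.
  by move/matrixP/(_ j 0)/eqP; rewrite !mxE !eqxx oner_eq0.
split; first exact: spec_herm.
move=> x x0; rewrite spec_quad; set y := U *m x.
have y0 : y != 0.
  by apply: contra x0 => /eqP h'; rewrite -[x]mul1mx -(unitarymx_adjl hU) -mulmxA -/y h' mulmx0.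
have [j yj] : exists j, y j 0 != 0.
  apply/existsP; move: y0; apply: contraR; rewrite negb_exists => /forallP hy.
  by apply/eqP/colP => j; have := hy j; rewrite negbK => /eqP ->; rewrite mxE.
rewrite (bigD1 j) //= ltr_pwDl //.
  by rewrite mulr_gt0 ?ltcR ?h // exprn_gt0 // normr_gt0.
by rewrite sumr_ge0 // => l _; rewrite mulr_ge0 ?ler0c ?exprn_ge0 // ltW.
Qed.

End Loewner.

(** * Functional calculus *)

Section FunctionalCalculus.
Variables (R : realType).
Local Notation C := R[i].
Local Notation "x %:RC" := (x%:C%C : C) (at level 2, format "x %:RC").

Lemma rscalar_mxN k (a : R) : rscalar_mx k (- a) = - rscalar_mx k a.
Proof.
have E : (- a)%:RC = - a%:RC by rewrite rmorphN.
by rewrite /rscalar_mx E; exact: raddfN.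
Qed.

(** The spectrum of a Hermitian [A] lies in [P]. Packaging the diagonalization with the predicate
    lets scalar facts on [P] transfer directly to matrices, as in [funmx_le]. *)
Definition eigen_in k (P : R -> Prop) (A : 'M[C]_k) :=
  exists U d, [/\ U \is unitarymx, A = spec U d & forall j, P (d 0 j)].

Lemma eigen_in_pd k (A : 'M[C]_k) : pdmx A -> eigen_in (fun x => 0 < x) A.
Proof.
move=> pA; have [U [d [hU hA]]] := spec_exists pA.1.
by exists U, d; split=> //; apply/(pdmx_spec _ hU); rewrite -hA.
Qed.

Lemma scalar_le_spec k (U : 'M[C]_k) d a : U \is unitarymx ->
  loewner_le (rscalar_mx k a) (spec U d) -> forall j, a <= d 0 j.
Proof.
move=> hU ha j; have {}ha : psdmx (spec U (d + const_mx (- a))).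
  by rewrite -specD (spec_const _ hU) rscalar_mxN.
by have /(_ j) := (psdmx_spec _ hU).1 ha; rewrite !mxE subr_ge0.
Qed.

Lemma spec_le_scalar k (U : 'M[C]_k) d b : U \is unitarymx ->
  loewner_le (spec U d) (rscalar_mx k b) -> forall j, d 0 j <= b.
Proof.
move=> hU hb j; have {}hb : psdmx (spec U (const_mx b + (-1) *: d)).
  by rewrite -specD (spec_const _ hU) -specZ rmorphN1 scaleN1r.
by have /(_ j) := (psdmx_spec _ hU).1 hb; rewrite !mxE mulN1r subr_ge0.
Qed.

Lemma eigen_in_itv k (A : 'M[C]_k) (a b : R) : A \is hermsymmx ->
  loewner_le (rscalar_mx k a) A -> loewner_le A (rscalar_mx k b) ->
  eigen_in (fun x => a <= x <= b) A.
Proof.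
move=> /spec_exists [U [d [hU ->]]] ha hb.
exists U, d; split; [exact: hU | by [] |] => j; apply/andP; split.
  exact: scalar_le_spec hU ha j.
exact: spec_le_scalar hU hb j.
Qed.

Lemma eigen_in_pd_le k (A : 'M[C]_k) (b : R) : pdmx A ->
  loewner_le A (rscalar_mx k b) -> eigen_in (fun x => 0 < x <= b) A.
Proof.
move=> pA; have [U [d [hU hA]]] := spec_exists pA.1.
move: pA; rewrite hA => /(pdmx_spec _ hU) d0 hb.
exists U, d; split; [exact: hU | by [] |] => j; apply/andP; split; first exact: d0.
exact: spec_le_scalar hU hb j.
Qed.

Lemma funmx_herm k f (A : 'M[C]_k) : A \is hermsymmx -> funmx f A \is hermsymmx.
Proof. by move=> /spec_exists [U [d [hU ->]]]; rewrite (funmx_spec f _ hU); exact: spec_herm. Qed.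

Lemma funmx_le k P f h (A : 'M[C]_k) : eigen_in P A ->
  (forall x, P x -> f x <= h x) -> loewner_le (funmx f A) (funmx h A).
Proof.
move=> [U [d [hU -> hd]]] hfh; rewrite /loewner_le !(funmx_spec _ _ hU).
rewrite -[- spec _ _]scaleN1r -(rmorphN1 (real_complex R)) specZ specD.
by apply/(psdmx_spec _ hU) => j; rewrite !mxE mulN1r subr_ge0 hfh.
Qed.

Lemma funmx_pd k P f (A : 'M[C]_k) : eigen_in P A ->
  (forall x, P x -> 0 < f x) -> pdmx (funmx f A).
Proof.
move=> [U [d [hU -> hd]]] hf; rewrite (funmx_spec _ _ hU).
by apply/(pdmx_spec _ hU) => j; rewrite !mxE hf.
Qed.

Lemma funmx_eq k P f h (A : 'M[C]_k) : eigen_in P A ->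
  (forall x, P x -> f x = h x) -> funmx f A = funmx h A.
Proof.
move=> [U [d [hU -> hd]]] hfh; rewrite !(funmx_spec _ _ hU).
by suff -> : map_mx f d = map_mx h d by []; apply/rowP => j; rewrite !mxE hfh.
Qed.

Lemma funmxM k f h (A : 'M[C]_k) : A \is hermsymmx ->
  funmx f A *m funmx h A = funmx (fun x => f x * h x) A.
Proof.
move=> /spec_exists [U [d [hU ->]]]; rewrite !(funmx_spec _ _ hU) (specM _ _ hU).
by suff -> : map_mx (fun x => f x * h x) d = \row_j (map_mx f d 0 j * map_mx h d 0 j)
  by []; apply/rowP => j; rewrite !mxE.
Qed.

Lemma funmx_commute k f h (A : 'M[C]_k) : A \is hermsymmx ->
  funmx f A *m funmx h A = funmx h A *m funmx f A.
Proof.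
move=> hA; apply: (etrans (funmxM f h hA)); apply: (etrans _ (esym (funmxM h f hA))).
suff -> : (fun x => f x * h x) = (fun x => h x * f x) by [].
by apply/funext => x; rewrite mulrC.
Qed.

Lemma funmxD k f h (A : 'M[C]_k) : A \is hermsymmx ->
  funmx f A + funmx h A = funmx (fun x => f x + h x) A.
Proof.
move=> /spec_exists [U [d [hU ->]]]; rewrite !(funmx_spec _ _ hU) specD.
by suff -> : map_mx (fun x => f x + h x) d = map_mx f d + map_mx h d
  by []; apply/rowP => j; rewrite !mxE.
Qed.

Lemma funmxZ k c f (A : 'M[C]_k) : A \is hermsymmx ->
  c%:RC *: funmx f A = funmx (fun x => c * f x) A.
Proof.
move=> /spec_exists [U [d [hU ->]]]; rewrite !(funmx_spec _ _ hU) specZ.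
by suff -> : map_mx (fun x => c * f x) d = c *: map_mx f d
  by []; apply/rowP => j; rewrite !mxE.
Qed.

Lemma funmx_cst k c (A : 'M[C]_k) : A \is hermsymmx ->
  funmx (fun=> c) A = rscalar_mx k c.
Proof.
move=> /spec_exists [U [d [hU ->]]]; rewrite !(funmx_spec _ _ hU).
rewrite -(spec_const c hU).
by suff -> : map_mx (fun=> c) d = const_mx c by []; apply/rowP => j; rewrite !mxE.
Qed.

Lemma funmx_id k (A : 'M[C]_k) : A \is hermsymmx -> funmx id A = A.
Proof.
move=> /spec_exists [U [d [hU ->]]]; rewrite !(funmx_spec _ _ hU).
by suff -> : map_mx id d = d by []; apply/rowP => j; rewrite !mxE.
Qed.

Lemma funmx_comp k f h (A : 'M[C]_k) : A \is hermsymmx ->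
  funmx f (funmx h A) = funmx (f \o h) A.
Proof.
move=> /spec_exists [U [d [hU ->]]]; rewrite !(funmx_spec _ _ hU).
by suff -> : map_mx f (map_mx h d) = map_mx (f \o h) d by [];
  apply/rowP => j; rewrite !mxE.
Qed.

Lemma funmx_affine k a b (A : 'M[C]_k) : A \is hermsymmx ->
  funmx (fun x => a * x + b) A = a%:RC *: A + rscalar_mx k b.
Proof.
by move=> hA; rewrite -{2}(funmx_id hA) funmxZ // -(funmx_cst b hA) funmxD.
Qed.

Lemma mulmx_funV k (A : 'M[C]_k) : pdmx A -> A *m funmx GRing.inv A = 1%:M.
Proof.
move=> pA; rewrite -{1}(funmx_id pA.1) (funmxM _ _ pA.1).
rewrite (funmx_eq (h := fun=> 1) (eigen_in_pd pA)).
  by rewrite (funmx_cst _ pA.1) /rscalar_mx rmorph1.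
by move=> x x0; rewrite mulfV ?gt_eqF.
Qed.

Lemma funV_mulmx k (A : 'M[C]_k) : pdmx A -> funmx GRing.inv A *m A = 1%:M.
Proof. by move/mulmx_funV/mulmx1C. Qed.

Lemma pdmx_funV k (A : 'M[C]_k) : pdmx A -> pdmx (funmx GRing.inv A).
Proof. by move/eigen_in_pd/funmx_pd; apply=> x; rewrite invr_gt0. Qed.

(** With [X] and [Y] the inverses of [A] and [B], this displays the difference of the inverses as a
    sum of two congruences, of [A] and of [B - A]. Both are positive semidefinite when [A] is
    positive definite and [A <= B], so inversion is order reversing. *)
Lemma inv_diff k (A B X Y : 'M[C]_k) :
  A *m X = 1%:M -> X *m A = 1%:M -> Y *m B = 1%:M ->
  (X - Y) *m A *m (X - Y) + Y *m (B - A) *m Y = X - Y.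
Proof.
move=> AX XA YB; rewrite mulmxBl XA (mulmxBr Y B A) YB !mulmxBl !mulmxBr !mul1mx.
by rewrite -(mulmxA Y A X) AX mulmx1 subrK.
Qed.

Lemma loewner_le_inv k (A B : 'M[C]_k) : pdmx A -> pdmx B -> loewner_le A B ->
  loewner_le (funmx GRing.inv B) (funmx GRing.inv A).
Proof.
move=> pA pB hAB; have hiA := funmx_herm GRing.inv pA.1.
have hiB := funmx_herm GRing.inv pB.1.
rewrite /loewner_le -(inv_diff (mulmx_funV pA) (funV_mulmx pA) (funV_mulmx pB)).
exact: (psdmxD (psdmx_congrH (hermsymB hiA hiB) (pdmx_psd pA))
               (psdmx_congrH hiB hAB)).
Qed.

(** Inversion and negation each reverse the order. This duality turns the upper tangent bound of
    [scrL_le] into the lower one of [scrL_ge]. *)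
Lemma operator_monotone_dual (g : R -> R) :
  operator_monotone g -> operator_monotone (fun x => - g x^-1).
Proof.
move=> hg k A B pA pB hAB.
have E (X : 'M[C]_k) : pdmx X ->
    funmx (fun x => - g x^-1) X = - funmx g (funmx GRing.inv X).
  move=> pX; rewrite (funmx_comp _ _ pX.1) -scaleN1r -(rmorphN1 (real_complex R)).
  rewrite (funmxZ _ _ pX.1); apply: (funmx_eq (eigen_in_pd pX)) => x _.
  by rewrite mulN1r.
rewrite (E _ pA) (E _ pB) /loewner_le opprK addrC.
exact: (hg _ _ _ (pdmx_funV pB) (pdmx_funV pA) (loewner_le_inv pA pB hAB)).
Qed.

End FunctionalCalculus.

(** * Scalar power inequalities *)

Section ScalarInequalities.
Variable R : realType.

(** Young's inequality for the product [y * 1] with conjugate exponents [p] and [p / (p - 1)],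
    multiplied by [p]. *)
Lemma bernoulli_powR (y p : R) : 1 < p -> 0 <= y -> p * y - (p - 1) <= y `^ p.
Proof.
move=> p1 y0; have p0 : 0 < p by lra.
have q0 : 0 < p / (p - 1) by rewrite divr_gt0 //; lra.
have hpq : p^-1 + (p / (p - 1))^-1 = 1 by field; lra.
have := conjugate_powR y0 ler01 p0 q0 hpq.
rewrite mulr1 powR1 mul1r invf_div => h.
have {}h : p * y <= p * (y `^ p / p + (p - 1) / p) by rewrite ler_pM2l.
have E : p * (y `^ p / p + (p - 1) / p) = y `^ p + (p - 1) by field; lra.
lra.
Qed.

(** The left side is the tangent line of the power function at [x], evaluated at [y]; it is
    Bernoulli's inequality at [y / x], scaled by [x ^ p]. *)
Lemma powR_tangent (x y p : R) : 1 <= p -> 0 < x -> 0 < y ->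
  x `^ p * (p * (y / x) - (p - 1)) <= y `^ p.
Proof.
move=> p1 x0 y0; have [->|p1'] := eqVneq p 1.
  rewrite (powRr1 (ltW x0)) (powRr1 (ltW y0)).
  have -> : x * (1 * (y / x) - (1 - 1)) = y by field; lra.
  exact: lexx.
have xp := powR_gt0 p x0.
have p1s : 1 < p by rewrite lt_neqAle eq_sym p1' p1.
have yx0 := divr_ge0 (ltW y0) (ltW x0).
have -> : y `^ p = x `^ p * (y / x) `^ p.
  by rewrite -(powRM _ (ltW x0) yx0) mulrC divfK ?gt_eqF.
by rewrite ler_pM2l // bernoulli_powR.
Qed.

(** The tangent at [x] is evaluated at both endpoints. With weights [M - x] and [x - m] the terms in
    [p] cancel, leaving [(M - m) * x ^ p]. *)
Lemma powR_chord (m M x p : R) : 1 <= p -> 0 < m -> m < M -> m <= x <= M ->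
  x `^ p <= (M `^ p - m `^ p) / (M - m) * x
            + (M * m `^ p - m * M `^ p) / (M - m).
Proof.
move=> p1 m0 mM /andP[mx xM]; have x0 : 0 < x by lra.
have hm := powR_tangent p1 x0 m0.
have hM := powR_tangent p1 x0 (lt_trans m0 mM).
have -> : (M `^ p - m `^ p) / (M - m) * x + (M * m `^ p - m * M `^ p) / (M - m)
   = ((M - x) * m `^ p + (x - m) * M `^ p) / (M - m) by field; lra.
rewrite ler_pdivlMr ?subr_gt0 //.
have h1 : (M - x) * (x `^ p * (p * (m / x) - (p - 1))) <= (M - x) * m `^ p.
  by rewrite ler_wpM2l // subr_ge0.
have h2 : (x - m) * (x `^ p * (p * (M / x) - (p - 1))) <= (x - m) * M `^ p.
  by rewrite ler_wpM2l // subr_ge0.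
apply: le_trans (lerD h1 h2); rewrite le_eqVlt; apply/orP; left; apply/eqP.
by field; lra.
Qed.

(** For [p > 1], with [D = m M^p - M m^p], the chord is [D / ((p - 1) (M - m))] times
    [p y - (p - 1)], where [y] is the base of the [p]-th power in the constant, times [x];
    Bernoulli's inequality at [y] concludes. Here [x] is any positive number, possibly outside
    [[m, M]], as the application at [K(h,2) s] requires. *)
Lemma gen_kantorovich_bound (m M x p : R) : 1 <= p -> 0 < m -> m < M -> 0 < x ->
  (M `^ p - m `^ p) / (M - m) * x + (M * m `^ p - m * M `^ p) / (M - m)
  <= gen_kantorovich m M p * x `^ p.
Proof.
move=> p1 m0 mM x0; have M0 := lt_trans m0 mM; rewrite /gen_kantorovich.
case: eqVneq => [->|pn1].
  rewrite !powRr1 ?(ltW m0) ?(ltW M0) ?(ltW x0) // mul1r le_eqVlt; apply/orP; left; apply/eqP.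
  by field; lra.
have {pn1}p1' : 1 < p by rewrite lt_neqAle eq_sym pn1.
set E := M `^ p - m `^ p; set D := m * M `^ p - M * m `^ p.
have E0 : 0 < E.
  by rewrite subr_gt0; apply: gt0_ltr_powR; rewrite ?nnegrE ?(ltW m0) ?(ltW M0) //; lra.
have D0 : 0 < D.
  have p0 : 0 < p by lra.
  (* Factoring gives [D = m M (M^(p-1) - m^(p-1))], which is positive because [p > 1]. *)
  rewrite subr_gt0 -(mulr_powRB1 (ltW M0) p0) -(mulr_powRB1 (ltW m0) p0).
  rewrite mulrCA ltr_pM2l // ltr_pM2l //.
  by apply: gt0_ltr_powR; rewrite ?nnegrE ?(ltW m0) ?(ltW M0) //; lra.
have y0 : 0 < (p - 1) / p * (E / D).
  by rewrite !mulr_gt0 ?invr_gt0 //; lra.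
rewrite -[leRHS]mulrA -(powRM _ (ltW y0) (ltW x0)); set y := _ * (E / D) * x.
have hy : 0 <= y := mulr_ge0 (ltW y0) (ltW x0).
have h := bernoulli_powR p1' hy.
have c0 : 0 < D / ((p - 1) * (M - m)) by rewrite divr_gt0 ?mulr_gt0 //; lra.
apply: le_trans (_ : D / ((p - 1) * (M - m)) * (p * y - (p - 1)) <= _); last first.
  by rewrite ler_pM2l.
have -> : M * m `^ p - m * M `^ p = - D by rewrite opprB.
rewrite le_eqVlt; apply/orP; left; apply/eqP; rewrite /y.
field; rewrite ?gt_eqF //; lra.
Qed.

(** At [x = M] the two chord bounds combine into [M^p <= K(m,M,p) M^p], and [M^p] is positive. *)
Lemma gen_kantorovich_gt0 (m M p : R) : 1 <= p -> 0 < m -> m < M ->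
  0 < gen_kantorovich m M p.
Proof.
move=> p1 m0 mM; have M0 := lt_trans m0 mM.
have mMM : m <= M <= M by rewrite lexx ltW.
have := le_trans (powR_chord p1 m0 mM mMM) (gen_kantorovich_bound p1 m0 mM M0).
by have /ltr_pM2r <- := powR_gt0 p M0; rewrite mul0r; apply: lt_le_trans; exact: powR_gt0.
Qed.

End ScalarInequalities.

(** * Tangent bounds for operator monotone functions *)

Section TangentBounds.
Variables (R : realType).
Local Notation C := R[i].
Local Notation "x %:RC" := (x%:C%C : C) (at level 2, format "x %:RC").

Lemma spec_entry k (U : 'M[C]_k) d i j :
  (spec U d) i j = \sum_l (U l i)^* * (d 0 l)%:RC * U l j.
Proof.
rewrite /spec /rdiag mul_mx_diag mxE; apply: eq_bigr => l _.
by rewrite !mxE.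
Qed.

(** A real symmetric reflection with first row [(sqrt t, sqrt (1 - t))], so that conjugating
    [diag (x, y)] by it puts [t x + (1 - t) y] in the upper left corner. *)
Definition rot2 (t : R) : 'M[C]_2 :=
  \matrix_(i, j) (if i == j then (if i == 0 then Num.sqrt t else - Num.sqrt t)
                  else Num.sqrt (1 - t))%:RC.

Lemma rot2_unitary t : 0 <= t <= 1 -> rot2 t \is unitarymx.
Proof.
move=> /andP[t0 t1]; have t1' : 0 <= 1 - t by rewrite subr_ge0.
have hs := sqr_sqrtr t0; have hc := sqr_sqrtr t1'.
apply/unitarymxP/matrixP => i j; rewrite !mxE !big_ord_recl big_ord0 !mxE.
by case: i => [[|[|?]] ?] //; case: j => [[|[|?]] ?] //=; rewrite !conj_RC addr0
  -!rmorphM -rmorphD /=; apply: congr1; lra.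
Qed.

Definition row2 (x y : R) : 'rV[R]_2 := \row_j (if j == 0 then x else y).

Lemma map_row2 (f : R -> R) x y : map_mx f (row2 x y) = row2 (f x) (f y).
Proof. by apply/rowP => j; rewrite !mxE; case: ifP. Qed.

Lemma spec_rot2 t x y : 0 <= t <= 1 ->
  spec (rot2 t) (row2 x y) =
  \matrix_(i, j) (if i == j then (if i == 0 then t * x + (1 - t) * y
                                  else (1 - t) * x + t * y)
                  else Num.sqrt t * Num.sqrt (1 - t) * (x - y))%:RC.
Proof.
move=> /andP[t0 t1]; have t1' : 0 <= 1 - t by rewrite subr_ge0.
have hs := sqr_sqrtr t0; have hc := sqr_sqrtr t1'.
apply/matrixP => i j; rewrite spec_entry !big_ord_recl big_ord0 !mxE.
case: i => [[|[|?]] ?] //; case: j => [[|[|?]] ?] //=; rewrite !conj_RC addr0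
  -!rmorphM -rmorphD /=; apply: congr1.
- transitivity (Num.sqrt t ^+ 2 * x + Num.sqrt (1 - t) ^+ 2 * y); first by ring.
  by rewrite hs hc.
- by ring.
- by ring.
- transitivity (Num.sqrt (1 - t) ^+ 2 * x + Num.sqrt t ^+ 2 * y); first by ring.
  by rewrite hs hc.
Qed.

Lemma spec1_row2 x y :
  spec 1%:M (row2 x y) =
  \matrix_(i, j) (if i == j then (if i == 0 then x else y) else 0)%:RC.
Proof.
rewrite /spec trmx1 map_mx1 mul1mx mulmx1 /rdiag; apply/matrixP => i j; rewrite !mxE.
by case: i => [[|[|?]] ?] //; case: j => [[|[|?]] ?].
Qed.

(** The value of [c] makes the Schur complement of the difference vanish: with [b] the off-diagonal
    entry, the difference is [e] times the Gram matrix of the row [(1, - b / e)]. The slack [e > 0]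
    absorbs [b], and the lower bound on [c] later ensures its positivity. *)
Lemma spec_rot2_le t x y e : 0 <= t <= 1 -> 0 < e ->
  exists2 c, (1 - t) * x + t * y <= c &
    loewner_le (spec (rot2 t) (row2 x y))
               (spec 1%:M (row2 (t * x + (1 - t) * y + e) c)).
Proof.
move=> t01 e0; set b := Num.sqrt t * Num.sqrt (1 - t) * (x - y).
exists ((1 - t) * x + t * y + b ^+ 2 / e).
  by rewrite lerDl divr_ge0 ?sqr_ge0 // ltW.
rewrite spec_rot2 // spec1_row2 -/b.
pose Y : 'rV[C]_2 := \row_j (if j == 0 then 1 else - (b / e))%:RC.
have gram (P Q : 'M[C]_2) : Q - P = e%:RC *: (Y^t* *m Y) -> loewner_le P Q.
  by move=> h; rewrite /loewner_le h; exact: (psdmxZ (ltW e0) (psdmx_gram Y)).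
apply: gram.
apply/matrixP => i j; rewrite !mxE big_ord_recl big_ord0 !mxE.
by case: i => [[|[|?]] ?] //; case: j => [[|[|?]] ?] //=; rewrite !conj_RC addr0
  -!rmorphM -rmorphB /=; apply: congr1; field; lra.
Qed.

(* [spec (rot2 t) (row2 x y)] has upper left entry [t x + (1 - t) y]; a diagonal
   matrix dominates it once its lower right entry is large, and comparing the
   upper left entries of [g] of both gives the inequality. *)
Lemma operator_monotone_concave (g : R -> R) x y t e :
  operator_monotone g -> 0 < x -> 0 < y -> 0 <= t <= 1 -> 0 < e ->
  t * g x + (1 - t) * g y <= g (t * x + (1 - t) * y + e).
Proof.
move=> hg x0 y0 t01 e0; have [c hc hle] := spec_rot2_le x y t01 e0.
have hU := rot2_unitary t01.
have h1 : (1%:M : 'M[C]_2) \is unitarymx.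
  by apply/unitarymxP; rewrite trmx1 map_mx1 mulmx1.
have pA : pdmx (spec (rot2 t) (row2 x y)).
  by apply/(pdmx_spec _ hU) => j; rewrite mxE; case: ifP.
have [t0 t1] := andP t01; have t1' : 0 <= 1 - t by rewrite subr_ge0.
have a0 : 0 < t * x + (1 - t) * y by nra.
have c0 : 0 < c by nra.
have pB : pdmx (spec 1%:M (row2 (t * x + (1 - t) * y + e) c)).
  by apply/(pdmx_spec _ h1) => j; rewrite mxE; case: ifP => // _; lra.
have := psdmx_diag_ge0 0 (hg _ _ _ pA pB hle).
rewrite (funmx_spec _ _ hU) (funmx_spec _ _ h1) !map_row2 spec_rot2 // spec1_row2.
by rewrite !mxE /= -rmorphB ler0c subr_ge0.
Qed.

Local Open Scope classical_set_scope.

(** Concavity between [1] and [x] with slack [t^2] gives [t g(x) <= g(1 + t (x - 1) + t^2)].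
    Dividing by [t] and letting [t] tend to [0] from the right yields [g'(1) (x - 1)], since the
    slack is of smaller order than [t]. *)
Lemma scrL_le (g : R -> R) x : scrL g -> 0 < x -> g x <= x - 1.
Proof.
(* [h] is the Carathéodory slope of [g] at [1]: [g y - g 1 = h y * (y - 1)], with [h] continuous at
   [1] and [h 1 = 1]. *)
move=> [hg g1 /is_derive1_caratheodory [h [hE hC h1]]] x0.
pose u (t : R) := 1 + t * (x - 1 + t).
have hu t : 0 < t < 1 -> g x <= h (u t) * (x - 1 + t).
  move=> /andP[t0 t1]; have t01 : 0 <= t <= 1 by rewrite !ltW.
  have e0 : 0 < t ^+ 2 by rewrite exprn_gt0.
  have := operator_monotone_concave hg x0 ltr01 t01 e0.
  rewrite g1 mulr0 addr0.
  have -> : t * x + (1 - t) * 1 + t ^+ 2 = u t by rewrite /u; ring.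
  have := hE (u t); rewrite g1 subr0 => ->.
  have -> : h (u t) * (u t - 1) = t * (h (u t) * (x - 1 + t)) by rewrite /u; ring.
  by rewrite ler_pM2l.
have hv : (fun t : R => x - 1 + t) @ 0^'+ --> x - 1.
  rewrite -[X in _ --> X]addr0; apply: cvgD; first exact: cvg_cst.
  exact: cvg_at_right_filter.
have hcu : u @ 0^'+ --> (1 : R).
  have -> : (1 : R) = 1 + 0 * (x - 1) by rewrite mul0r addr0.
  apply: cvgD; first exact: cvg_cst.
  by apply: cvgM => //; exact: cvg_at_right_filter.
have hlim : (fun t => h (u t) * (x - 1 + t)) @ 0^'+ --> x - 1.
  have h1E : h 1 * (x - 1) = x - 1 by rewrite h1 mul1r.
  rewrite -[X in _ --> X]h1E; apply: cvgM => //.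
  exact: (cvg_comp _ _ hcu hC).
rewrite -(cvg_lim _ hlim) //; apply: limr_ge; first by apply/cvg_ex; exists (x - 1).
near=> t; apply: hu; apply/andP; split; near: t.
- exact: nbhs_right_gt.
- exact: nbhs_right_lt.
Unshelve. all: by end_near.
Qed.

(** The dual function [y |-> - g (y^-1)] again lies in [scrL]; its upper bound at [x^-1] is the
    claim. *)
Lemma scrL_ge (g : R -> R) x : scrL g -> 0 < x -> 1 - x^-1 <= g x.
Proof.
move=> [hg g1 hd] x0; have xV0 : 0 < x^-1 by rewrite invr_gt0.
have hL : scrL (fun y => - g y^-1).
  split; first exact: operator_monotone_dual hg.
  - by rewrite invr1 g1 oppr0.
  have hV : is_derive (1 : R) 1 (fun y : R => y^-1) (- 1).
    have := @is_deriveV R id 1 1 1 (oner_neq0 _) (is_derive_id _ _).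
    by rewrite expr1n invr1 /GRing.scale /= mulr1.
  have hd' : is_derive ((1 : R)^-1) 1 g 1 by rewrite invr1.
  have := is_deriveN (is_derive1_comp hd' hV).
  by rewrite mul1r opprK.
have := scrL_le hL xV0.
by rewrite invrK lerNl opprB.
Qed.

End TangentBounds.

(** * Monotonicity of unitarily invariant norms *)

Section Norm.
Variables (R : realType).
Local Notation C := R[i].
Local Notation "x %:RC" := (x%:C%C : C) (at level 2, format "x %:RC").

Lemma powmx_halves k (X : 'M[C]_k) : pdmx X ->
  let H := powmx X (2^-1) in let T := powmx X (- 2^-1) in
  [/\ pdmx H, pdmx T, H *m T = 1%:M, T *m H = 1%:M & H *m H = X].
Proof.
move=> pX H T; have eX := eigen_in_pd pX.
have HT : H *m T = 1%:M.
  rewrite /H /T /powmx (funmxM _ _ pX.1) (funmx_eq (h := fun=> 1) eX).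
    by rewrite (funmx_cst _ pX.1) /rscalar_mx rmorph1.
  by move=> x x0; rewrite powRN mulfV // gt_eqF // powR_gt0.
split; [| | exact: HT | exact: mulmx1C HT |].
- by apply: (funmx_pd eX) => x x0; exact: powR_gt0.
- by apply: (funmx_pd eX) => x x0; exact: powR_gt0.
rewrite /H /powmx (funmxM _ _ pX.1) -[RHS](funmx_id pX.1).
by apply: (funmx_eq eX) => x x0; rewrite powR12_sqrt ?ltW // -expr2 sqr_sqrtr ?ltW.
Qed.

(* The unitary is [V = P + i sqrt (1 - P^2)] with [P = sqrt L]. *)
Lemma contraction_unitary_mean k (L : 'M[C]_k) :
  L \is hermsymmx -> eigen_in (fun x => 0 < x <= 1) L ->
  exists2 V : 'M[C]_k, V \is unitarymx &
    V + V^t* = 2%:R *: funmx Num.sqrt L.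
Proof.
move=> hL eL; pose q (x : R) := Num.sqrt (1 - x).
have hP := (hermsymP _).1 (funmx_herm Num.sqrt hL).
have hQ := (hermsymP _).1 (funmx_herm q hL).
have PQ := funmx_commute q Num.sqrt hL.
have PQ1 : funmx Num.sqrt L *m funmx Num.sqrt L + funmx q L *m funmx q L = 1%:M.
  have E := congr2 +%R (funmxM Num.sqrt Num.sqrt hL) (funmxM q q hL).
  apply: (etrans E); rewrite (funmxD _ _ hL).
  rewrite (funmx_eq (h := fun=> 1) eL) => [|x /andP[x0 x1]].
    by rewrite (funmx_cst 1 hL) /rscalar_mx rmorph1.
  have x1' : 0 <= 1 - x by rewrite subr_ge0.
  by rewrite /q -!expr2 (sqr_sqrtr (ltW x0)) (sqr_sqrtr x1') addrC subrK.
move: (funmx Num.sqrt L) (funmx q L) hP hQ PQ PQ1 => P Q hP hQ PQ PQ1.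
have hV : (P + Num.imaginary *: Q)^t* = P - Num.imaginary *: Q.
  by rewrite mxadjD mxadjZ hP hQ conjCi scaleNr.
exists (P + Num.imaginary *: Q).
  apply/unitarymxP; rewrite hV mulmxDl !mulmxBr -!scalemxAr -!scalemxAl PQ.
  rewrite addrA subrK scalerA -expr2 sqrCi scaleN1r opprK.
  exact: PQ1.
by rewrite hV addrACA subrr addr0 scaler_nat mulr2n.
Qed.

Lemma normc_RC (x : R) : ComplexField.Normc.normc (x%:RC) = `|x|.
Proof. by rewrite /ComplexField.Normc.normc /= expr0n addr0 sqrtr_sqr. Qed.

(** Since [P] is the mean of [V] and its adjoint, [P B P] is the average of four products of [B]
    with unitaries on both sides, each of norm [N B]. *)
Lemma unitarily_invariant_compress k (N : 'M[C]_k -> R) (P B V : 'M[C]_k) :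
  unitarily_invariant_norm N -> V \is unitarymx -> V + V^t* = 2%:R *: P ->
  N (P *m B *m P) <= N B.
Proof.
move=> [[tri homog _] inv] hV hP; have hV' : V^t* \is unitarymx by rewrite trmxC_unitary.
set c : R := 4^-1.
have E : P *m B *m P = c%:RC *: ((V *m B *m V + V *m B *m V^t*)
                               + (V^t* *m B *m V + V^t* *m B *m V^t*)).
  rewrite -!mulmxDr -!mulmxDl hP -!scalemxAl -scalemxAr !scalerA.
  suff -> : c%:RC * 2%:R * 2%:R = 1 by rewrite scale1r.
  by rewrite -mulrA -natrM /c fmorphV rmorph_nat mulVf // pnatr_eq0.
rewrite E homog normc_RC ger0_norm ?invr_ge0 // mulrC ler_pdivrMr //.
apply: (le_trans (tri _ _)); apply: (le_trans (lerD (tri _ _) (tri _ _))).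
rewrite (inv _ B _ hV hV) (inv _ B _ hV hV') (inv _ B _ hV' hV) (inv _ B _ hV' hV').
lra.
Qed.

(** The intended reading is [W = A^1/2], [T = B^-1/2], [P = (T A T)^1/2] and [Q = P^-1], so that
    [W T Q] is the unitary polar factor of [W T]. *)
Lemma polar_factor k (A B W T P Q : 'M[C]_k) :
  W^t* = W -> T^t* = T -> Q^t* = Q -> W *m W = A -> T *m B *m T = 1%:M ->
  P *m Q = 1%:M -> Q *m P = 1%:M -> P *m P = T *m A *m T ->
  W *m T *m Q \is unitarymx /\
  A = (W *m T *m Q) *m (P *m B *m P) *m (W *m T *m Q)^t*.
Proof.
move=> hW hT hQ WW TBT PQ QP PP.
have adjU : (W *m T *m Q)^t* = Q *m T *m W by rewrite !mxadjM hW hT hQ !mulmxA.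
split.
  apply/unitarymxP/mulmx1C; rewrite adjU.
  have -> : Q *m T *m W *m (W *m T *m Q) = Q *m (T *m (W *m W) *m T) *m Q.
    by rewrite !mulmxA.
  by rewrite WW -PP mulmxA QP mul1mx.
rewrite adjU.
have -> : W *m T *m Q *m (P *m B *m P) *m (Q *m T *m W)
          = W *m T *m (Q *m P) *m B *m (P *m Q) *m T *m W by rewrite !mulmxA.
rewrite QP PQ !mulmx1.
have -> : W *m T *m B *m T *m W = W *m (T *m B *m T) *m W by rewrite !mulmxA.
by rewrite TBT mulmx1 WW.
Qed.

(* With [L = B^-1/2 A B^-1/2 <= 1] and [U] the unitary polar factor of
   [A^1/2 B^-1/2 = U L^1/2], one has [A = U L^1/2 B L^1/2 U^t*]. *)
Lemma unitarily_invariant_mono k (N : 'M[C]_k -> R) (A B : 'M[C]_k) :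
  unitarily_invariant_norm N -> pdmx A -> pdmx B -> loewner_le A B -> N A <= N B.
Proof.
move=> hN pA pB hAB.
have := powmx_halves pA; set W := powmx A _ => -[[hW _] _ _ _ WW].
have [] := powmx_halves pB; set H := powmx B _; set T := powmx B _.
move=> [hH _] [hT _] HT TH HH.
have TBT : T *m B *m T = 1%:M by rewrite -HH mulmxA TH mul1mx HT.
have uT : T \in unitmx by exact: (mulmx1_unit TH).1.
pose L := T *m A *m T.
have pL : pdmx L by have := pdmx_congr uT pA; rewrite (hermsymP _).1.
have hL1 : loewner_le L (rscalar_mx k 1).
  have := psdmx_congrH hT hAB; rewrite mulmxBr mulmxBl TBT.
  by rewrite /rscalar_mx rmorph1.
have eL := eigen_in_pd_le pL hL1.
have [V hV VE] := contraction_unitary_mean pL.1 eL.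
set P := funmx _ L in VE; pose Q := funmx (fun x => (Num.sqrt x)^-1) L.
have PQ : P *m Q = 1%:M.
  rewrite (funmxM _ _ pL.1) (funmx_eq (h := fun=> 1) eL).
    by rewrite (funmx_cst _ pL.1) /rscalar_mx rmorph1.
  by move=> x /andP[x0 _]; rewrite mulfV // gt_eqF // sqrtr_gt0.
have QP : Q *m P = 1%:M by exact: mulmx1C.
have PP : P *m P = L.
  rewrite (funmxM _ _ pL.1) -[RHS](funmx_id pL.1).
  by apply: (funmx_eq eL) => x /andP[x0 _]; rewrite -expr2 sqr_sqrtr // ltW.
have /hermsymP hQ : Q \is hermsymmx := funmx_herm _ pL.1.
move/hermsymP: hW => hW; move/hermsymP: hT => hT.
have comp := unitarily_invariant_compress B hN hV VE.
rewrite (polar_factor hW hT hQ WW TBT PQ QP PP).2.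
have hU := (polar_factor hW hT hQ WW TBT PQ QP PP).1.
by rewrite hN.2 ?trmxC_unitary.
Qed.

End Norm.

(** * Bounds on the generalized Karcher mean *)

Section KarcherMean.
Variables (R : realType).
Local Notation C := R[i].
Local Notation "x %:RC" := (x%:C%C : C) (at level 2, format "x %:RC").

Definition wsum n k (w : 'I_n -> R) (A : 'I_n -> 'M[C]_k) : 'M[C]_k :=
  \sum_i (w i)%:RC *: A i.

Lemma wsum_le n k (w : 'I_n -> R) (A B : 'I_n -> 'M[C]_k) : weight_vector w ->
  (forall i, loewner_le (A i) (B i)) -> loewner_le (wsum w A) (wsum w B).
Proof.
move=> [w0 _] hAB; rewrite /loewner_le /wsum -sumrB; apply: psdmx_sum => i.
by rewrite -scalerBr; exact: psdmxZ (ltW (w0 i)) (hAB i).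
Qed.

Lemma wsum_affine n k (w : 'I_n -> R) (A : 'I_n -> 'M[C]_k) a b : weight_vector w ->
  wsum w (fun i => a%:RC *: A i + rscalar_mx k b)
  = a%:RC *: wsum w A + rscalar_mx k b.
Proof.
move=> [_ w1]; rewrite /wsum scaler_sumr.
under eq_bigr do rewrite scalerDr scalerA mulrC -scalerA.
rewrite big_split /= -scaler_suml -rmorph_sum w1 rmorph1 scale1r //.
Qed.

Lemma wsum_congr n k (w : 'I_n -> R) (A : 'I_n -> 'M[C]_k) Y :
  wsum w (fun i => Y *m A i *m Y) = Y *m wsum w A *m Y.
Proof.
rewrite /wsum mulmx_sumr mulmx_suml; apply: eq_bigr => i _.
by rewrite -scalemxAr -scalemxAl.
Qed.

Lemma mulmx_inv_unique k (Z Y D : 'M[C]_k) :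
  Y *m Z = 1%:M -> Z *m D = 1%:M -> Y = D.
Proof. by move=> YZ ZD; rewrite -[LHS]mulmx1 -ZD mulmxA YZ mul1mx. Qed.

Lemma congr_inv k (H T A D : 'M[C]_k) : T *m H = 1%:M -> A *m D = 1%:M ->
  T *m A *m T *m (H *m D *m H) = 1%:M.
Proof.
move=> TH AD; have -> : T *m A *m T *m (H *m D *m H) = T *m (A *m (T *m H) *m D) *m H.
  by rewrite !mulmxA.
by rewrite TH mulmx1 AD mulmx1.
Qed.

Lemma congr_sub1 k (H T B : 'M[C]_k) : H *m T = 1%:M -> T *m H = 1%:M ->
  H *m (T *m B *m T - rscalar_mx k 1) *m H = B - H *m H.
Proof.
move=> HT TH; rewrite mulmxBr mulmxBl /rscalar_mx rmorph1 mulmx1.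
have -> : H *m (T *m B *m T) *m H = (H *m T) *m B *m (T *m H) by rewrite !mulmxA.
by rewrite HT TH mul1mx mulmx1.
Qed.

(** With [T = X^-1/2], the bound [g x <= x - 1] on each [T A_i T], summed through the Karcher
    equation, gives [0 <= T (sum_i w_i A_i) T - 1]; congruence by [X^1/2] finishes. *)
Lemma is_sigma_le n k (g : R -> R) (w : 'I_n -> R) (A : 'I_n -> 'M[C]_k) X :
  scrL g -> weight_vector w -> (forall i, pdmx (A i)) -> is_sigma g w A X ->
  loewner_le X (wsum w A).
Proof.
move=> hg hw pA [pX]; have /= := powmx_halves pX.
move: (powmx X (2^-1)) (powmx X (- 2^-1)) => H T [[hH _] [hT _] HT TH HH] hsum.
have uT : T \in unitmx := (mulmx1_unit TH).1.
have pZ i : pdmx (T *m A i *m T).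
  by have := pdmx_congr uT (pA i); rewrite ((hermsymP _).1 hT).
have hle i : loewner_le (funmx g (T *m A i *m T))
                        (1%:RC *: (T *m A i *m T) + rscalar_mx k (- 1)).
  rewrite -(funmx_affine 1 (- 1) (pZ i).1).
  apply: (funmx_le (eigen_in_pd (pZ i))) => x x0.
  by rewrite mul1r; exact: scrL_le.
have := wsum_le hw hle; rewrite (wsum_affine _ _ _ hw) wsum_congr.
rewrite {1}/wsum hsum /loewner_le subr0 rmorph1 scale1r rscalar_mxN.
by move/(psdmx_congrH hH); rewrite (congr_sub1 _ HT TH) HH.
Qed.

(** The mirror image of [is_sigma_le]: [1 - 1/x <= g x] is used on [T A_i T], whose inverse is
    [H A_i^-1 H] with [H = X^1/2], and the final congruence is by [T]. *)
Lemma is_sigma_inv_le n k (g : R -> R) (w : 'I_n -> R) (A : 'I_n -> 'M[C]_k) X :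
  scrL g -> weight_vector w -> (forall i, pdmx (A i)) -> is_sigma g w A X ->
  loewner_le (funmx GRing.inv X) (wsum w (fun i => funmx GRing.inv (A i))).
Proof.
move=> hg hw pA [pX]; have /= := powmx_halves pX.
move: (powmx X (2^-1)) (powmx X (- 2^-1)) => H T [[hH _] [hT _] HT TH HH] hsum.
have uT : T \in unitmx := (mulmx1_unit TH).1.
have pZ i : pdmx (T *m A i *m T).
  by have := pdmx_congr uT (pA i); rewrite ((hermsymP _).1 hT).
set iA := fun i => funmx GRing.inv (A i).
have iZ i : funmx GRing.inv (T *m A i *m T) = H *m iA i *m H.
  have h : T *m A i *m T *m (H *m iA i *m H) = 1%:M.
    exact: congr_inv TH (mulmx_funV (pA i)).
  exact: mulmx_inv_unique (funV_mulmx (pZ i)) h.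
have hle i : loewner_le ((-1)%:RC *: (H *m iA i *m H) + rscalar_mx k 1)
                        (funmx g (T *m A i *m T)).
  rewrite -iZ -(funmx_cst 1 (pZ i).1) (funmxZ _ _ (pZ i).1) (funmxD _ _ (pZ i).1).
  apply: (funmx_le (eigen_in_pd (pZ i))) => x x0.
  by rewrite mulN1r addrC; exact: scrL_ge.
have := wsum_le hw hle; rewrite (wsum_affine _ _ _ hw) wsum_congr.
rewrite {2}/wsum hsum /loewner_le sub0r rmorphN1 scaleN1r opprD opprK.
move/(psdmx_congrH hT); rewrite (congr_sub1 _ TH HT).
suff -> : funmx GRing.inv X = T *m T by [].
apply: mulmx_inv_unique (funV_mulmx pX) _.
by rewrite -HH mulmxA -(mulmxA H H T) HT mulmx1.
Qed.

(** The cancellation behind [is_sigma_ge]: [u] is the inverse of [X], [y] the weighted sum, [s] and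
    [t] scalar matrices. The scalar [c] here is the square of the constant named [c] there. *)
Lemma scale_telescope (V : lmodType C) (K c a : C) (x y u s t : V) :
  c *: s = t -> K * (c * a) = - 1 ->
  K *: (x - (- c *: u + t) + c *: (a *: y + s - u)) = K *: x - y.
Proof.
move=> st Ka; rewrite scaleNr opprD opprK (scalerBr c) (scalerDr c) st scalerA.
have E (p q : V) : p - t + (q + t - p) = q by rewrite addrC addrA subrK addrK.
by rewrite -(addrA x) E scalerDr scalerA Ka scaleN1r.
Qed.

Lemma kantorovich_gt0 (h : R) : 0 < h -> 0 < kantorovich h.
Proof. by move=> h0; rewrite /kantorovich divr_gt0 ?exprn_gt0 ?mulr_gt0 ?addr_gt0. Qed.

(* [X + c^2 X^-1 >= 2 c] for [c = 2 m M / (m + M)], together with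
   [A_i^-1 <= (m + M - A_i) / (m M)]. *)
Lemma is_sigma_ge n k (g : R -> R) (w : 'I_n -> R) (A : 'I_n -> 'M[C]_k) m M X :
  scrL g -> weight_vector w -> (forall i, pdmx (A i)) -> 0 < m -> m < M ->
  (forall i, eigen_in (fun x => m <= x <= M) (A i)) -> is_sigma g w A X ->
  loewner_le (wsum w A) ((kantorovich (M / m))%:RC *: X).
Proof.
move=> hg hw pA m0 mM eA hX; have M0 := lt_trans m0 mM; have pX := hX.1.
have hinv := is_sigma_inv_le hg hw pA hX.
(* [a x + b] is the chord of [1/x] on [[m, M]]. *)
pose a := - (m * M)^-1; pose b := (m + M) / (m * M).
have hle i : loewner_le (funmx GRing.inv (A i)) (a%:RC *: A i + rscalar_mx k b).
  rewrite -(funmx_affine a b (pA i).1); apply: (funmx_le (eA i)) => x /andP[mx xM].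
  have x0 : 0 < x by lra.
  rewrite -subr_ge0 /a /b.
  have -> : - (m * M)^-1 * x + (m + M) / (m * M) - x^-1
            = (x - m) * (M - x) / (m * M * x).
    by field; rewrite !gt_eqF.
  by rewrite divr_ge0 // ?mulr_ge0 ?subr_ge0 // ltW.
have h1 := loewner_trans hinv (wsum_le hw hle).
rewrite (wsum_affine _ _ _ hw) in h1.
(* The harmonic mean of [m] and [M], that is [2 / b]: it makes the scalar terms cancel through
   [c^2 b = 2 c], and the remaining coefficient [c^2 / (m M)] is the inverse of the Kantorovich
   constant. *)
pose c := 2 * m * M / (m + M).
have h2 : loewner_le ((- c ^+ 2)%:RC *: funmx GRing.inv X + rscalar_mx k (2 * c)) X.
  rewrite -[X in loewner_le _ X](funmx_id pX.1) -(funmx_cst (2 * c) pX.1).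
  rewrite (funmxZ _ _ pX.1) (funmxD _ _ pX.1).
  apply: (funmx_le (eigen_in_pd pX)) => x x0; rewrite -subr_ge0.
  have -> : x - (- c ^+ 2 * x^-1 + 2 * c) = (x - c) ^+ 2 / x.
    by field; rewrite gt_eqF.
  by rewrite divr_ge0 ?sqr_ge0 // ltW.
have K0 : 0 < kantorovich (M / m) by rewrite kantorovich_gt0 ?divr_gt0.
have h3 := psdmxZ (ltW K0) (psdmxD h2 (psdmxZ (sqr_ge0 c) h1)).
move: h3; rewrite /loewner_le.
suff -> : (kantorovich (M / m))%:RC *:
    (X - ((- c ^+ 2)%:RC *: funmx GRing.inv X + rscalar_mx k (2 * c))
     + (c ^+ 2)%:RC *: (a%:RC *: wsum w A + rscalar_mx k b - funmx GRing.inv X))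
  = (kantorovich (M / m))%:RC *: X - wsum w A by [].
have e1 : kantorovich (M / m) * (c ^+ 2 * a) = - 1.
  by rewrite /kantorovich /c /a; field; rewrite !gt_eqF //; lra.
have e2 : c ^+ 2 * b = 2 * c by rewrite /c /b; field; rewrite !gt_eqF //; lra.
have -> : (- c ^+ 2)%:RC = - (c ^+ 2)%:RC by rewrite rmorphN.
have e2' : (2 * c)%:RC = (c ^+ 2)%:RC * b%:RC by rewrite -e2 [LHS]rmorphM.
apply: scale_telescope; first by rewrite /rscalar_mx e2' scale_scalar_mx.
by rewrite -!rmorphM e1 rmorphN1.
Qed.

End KarcherMean.

(** * Operator inequality for the powers and its consequences *)

Unset Implicit Arguments.

Theorem theorem2p1 (R : realType) (n k : nat) (g : R -> R)
    (w : 'I_n -> R) (A : 'I_n -> 'M[R[i]]_k) (m M : R)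
    (hg : scrL g) (hw : weight_vector w) (hA : forall i, pdmx (A i))
    (hm : 0 < m) (hmM : m < M)
    (hmA : forall i, loewner_le (rscalar_mx k m) (A i))
    (hAM : forall i, loewner_le (A i) (rscalar_mx k M))
    (p : R) (hp : 1 <= p) (S Sp : 'M[R[i]]_k)
    (hS : is_sigma g w A S)
    (hSp : is_sigma g w (fun i => powmx (A i) p) Sp) :
  (forall N : 'M[R[i]]_k -> R, unitarily_invariant_norm N ->
     N Sp <= gen_kantorovich m M p * kantorovich (M / m) `^ p
             * N (powmx S p)) /\
  (loewner_le S (rscalar_mx k 1) ->
   loewner_le Sp
     (rscalar_mx k (gen_kantorovich m M p * kantorovich (M / m) `^ p))).
Proof.
have hM := lt_trans hm hmM; have p0 : 0 <= p by rewrite (le_trans _ hp).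
have eA i := eigen_in_itv (hA i).1 (hmA i) (hAM i).
have pS := hS.1; have eS := eigen_in_pd pS.
have pAp i : pdmx (powmx (A i) p).
  by apply: (funmx_pd (eigen_in_pd (hA i))) => x; exact: powR_gt0.
set K := kantorovich (M / m); set C1 := gen_kantorovich m M p.
have K0 : 0 < K by rewrite kantorovich_gt0 ?divr_gt0.
have C0 : 0 < C1 * K `^ p by rewrite mulr_gt0 ?powR_gt0 ?gen_kantorovich_gt0.
pose a := (M `^ p - m `^ p) / (M - m).
pose b := (M * m `^ p - m * M `^ p) / (M - m).
(* A nonnegative chord slope allows the weighted sum of the [A_i] to be replaced by its upper bound
   [K S]. *)
have a0 : 0 <= a.
  rewrite divr_ge0 ?subr_ge0 ?(ltW hmM) // ge0_ler_powR ?nnegrE ?(ltW hm) ?(ltW hM) //.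
  exact: ltW.
have chord i : loewner_le (powmx (A i) p) (a%:C%C *: A i + rscalar_mx k b).
  rewrite -(funmx_affine a b (hA i).1); apply: (funmx_le (eA i)) => x hx.
  exact: powR_chord.
have h1 := loewner_trans (is_sigma_le hg hw pAp hSp) (wsum_le hw chord).
rewrite (wsum_affine _ _ _ hw) in h1.
have h2 := psdmxZ a0 (is_sigma_ge hg hw hA hm hmM eA hS).
(* Only functions of [S] occur here, so the scalar bound at [K x], for each eigenvalue [x] of [S],
   suffices. *)
have h3 : loewner_le ((a * K)%:C%C *: S + rscalar_mx k b)
                     ((C1 * K `^ p)%:C%C *: powmx S p).
  rewrite -(funmx_affine _ b pS.1) (funmxZ _ _ pS.1).
  apply: (funmx_le eS) => x x0.
  rewrite -(mulrA a) -(mulrA C1) -(powRM _ (ltW K0) (ltW x0)).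
  exact: gen_kantorovich_bound hp hm hmM (mulr_gt0 K0 x0).
have hle : loewner_le Sp ((C1 * K `^ p)%:C%C *: powmx S p).
  apply: loewner_trans h1 (loewner_trans _ h3); move: h2; rewrite -/K /loewner_le.
  by rewrite scalerBr scalerA -rmorphM opprD addrACA subrr addr0.
have pSpow : pdmx (powmx S p) by apply: (funmx_pd eS) => x; exact: powR_gt0.
split=> [N hN|hS1].
  apply: le_trans (unitarily_invariant_mono hN hSp.1 (pdmxZ C0 pSpow) hle) _.
  by case: hN => [[_ -> _] _]; rewrite normc_RC ger0_norm ?(ltW C0).
apply: (loewner_trans hle).
(* The power function need not be operator monotone for [p > 1]; comparison with the identity only
   involves the eigenvalues of [S], which lie in [(0, 1]]. *)
have hpow : loewner_le (powmx S p) (rscalar_mx k 1).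
  rewrite -(funmx_cst 1 pS.1); apply: (funmx_le (eigen_in_pd_le pS hS1)).
  move=> x /andP[x0 x1]; have <- : 1 `^ p = 1 :> R by rewrite powR1.
  by apply: ge0_ler_powR; rewrite ?nnegrE ?(ltW x0).
have := psdmxZ (ltW C0) hpow; rewrite /loewner_le scalerBr.
by rewrite /rscalar_mx rmorph1 scalemx1.
Qed.
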